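(* For $w_1\in\mathfrak{H}_{\sqcup\!\sqcup}^1$ and $w_0\in\mathfrak{H}_{\sqcup\!\sqcup}^0$, \[ \mathrm{L}_{<N}\bigl(\top(w_1)*\top(w_0)-\top(w_1\sqcup\!\sqcup w_0)\bigr)=O(N^{-1/3}\log^{m}N) \] as $N\to\infty$, for some positive integer $m$ independent of $N$.
   Context: Here $\sqcup\!\sqcup$ denotes the shuffle symbol. Let $\mathfrak{H}=\mathbb{Q}\langle e_z\mid z\in\mathbb{C}\rangle$, $e_{z,k}\coloneqq e_ze_0^{k-1}$, $e_{\boldsymbol{z},\boldsymbol{k}}\coloneqq e_{z_1,k_1}\cdots e_{z_r,k_r}$, $\mathfrak{H}^1\coloneqq\mathbb{Q}+\sum_{z\neq0}e_z\mathfrak{H}$, $\mathfrak{H}_{\sqcup\!\sqcup}\coloneqq\mathbb{Q}\langle e_0, e_z \mid |z|\geq 1\rangle$, $\mathfrak{H}_{\sqcup\!\sqcup}^1\coloneqq\mathbb{Q}+\sum_{|z|\geq 1}e_z\mathfrak{H}_{\sqcup\!\sqcup}$, $\mathfrak{H}_{\sqcup\!\sqcup}^0\coloneqq\mathbb{Q}+\sum_{|z|\geq 1}e_z\mathfrak{H}_{\sqcup\!\sqcup}e_0+\sum_{|z|,|w|\geq 1, w\neq 1}e_z\mathfrak{H}_{\sqcup\!\sqcup}e_w$. The shuffle product on $\mathfrak{H}_{\sqcup\!\sqcup}$ is $\mathbb{Q}$-bilinear with $w\sqcup\!\sqcup 1=1\sqcup\!\sqcup w=w$ and $wu_1\sqcup\!\sqcup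 w'u_2=(w\sqcup\!\sqcup w'u_2)u_1+(wu_1\sqcup\!\sqcup w')u_2$ for words $w,w'$ and letters $u_1,u_2\in\{e_z\mid z=0\text{ or }|z|\ge1\}$. The $\mathbb{Q}$-linear map $\top\colon\mathfrak{H}_{\sqcup\!\sqcup}^1\to\mathfrak{H}$ is given by $\top(1)=1$ and $\top(e_{z_1,k_1}\cdots e_{z_r,k_r})=e_{z_2/z_1,k_1}\cdots e_{z_r/z_{r-1},k_{r-1}}e_{z_r^{-1},k_r}$; set $\mathfrak{H}^1_*\coloneqq\top(\mathfrak{H}^1_{\sqcup\!\sqcup})$. The harmonic product $*$ on $\mathfrak{H}^1$ is $\mathbb{Q}$-bilinear with $w*1=1*w=w$ and $we_{\xi_1,k_1}*w'e_{\xi_2,k_2}=(w*w'e_{\xi_2,k_2})e_{\xi_1,k_1}+(we_{\xi_1,k_1}*w')e_{\xi_2,k_2}+(w*w')e_{\xi_1\xi_2,k_1+k_2}$ for $\xi_1,\xi_2\neq0$. The $\mathbb{Q}$-linear map $\mathrm{L}_{<N}\colon\mathfrak{H}^1_*\to\mathbb{C}$ is given by $\mathrm{L}_{<N}(1)=1$ and $\mathrm{L}_{<N}(e_{\boldsymbol{\xi},\boldsymbol{k}})=\sum_{0<n_1<\cdots<n_r<N}\frac{\xi_1^{n_1}\cdots\xi_r^{n_r}}{n_1^{k_1}\cdots n_r^{k_r}}$. *)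

(* Defs.v *)
From HB Require Import structures.
From mathcomp Require Import all_boot all_order all_algebra.
From mathcomp Require Import finmap complex monalg.
From mathcomp Require Import classical_sets reals topology normedtype.
From mathcomp Require Import landau exp.

Set Implicit Arguments.
Unset Strict Implicit.
Unset Printing Implicit Defensive.

Import Order.TTheory GRing.Theory Num.Theory.
Import numFieldNormedType.Exports.

Local Open Scope ring_scope.
Local Open Scope complex_scope.

(* Q<e_z | z in C>: finitely supported rational combinations of words in C. *)
Notation frakH R := {malg rat[{fmonom R[i]}]}.

Section Words.
Context {R : realType}.
Local Notation C := R[i].
Local Notation H := (frakH R).

Definition e_ (z : C) : H := << fmu z >>.

Definition e_pow (z : C) (k : nat) : H := e_ z * e_ 0 ^+ k.-1.

Definition e_idx (s : seq (C * nat)) : H := \prod_(zk <- s) e_pow zk.1 zk.2.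

Definition valid_idx (s : seq (C * nat)) : bool :=
  all (fun zk => (zk.1 != 0) && (0 < zk.2)%N) s.

(* Reads a word from the right; the first component counts the zeros that
   still await the nonzero letter on their left. *)
Definition parse (w : seq C) : nat * seq (C * nat) :=
  foldr (fun a p => if a == 0 then (p.1.+1, p.2)
                    else (0%N, (a, p.1.+1) :: p.2)) (0%N, [::]) w.

(* The words lying in Q + sum_{z != 0} e_z H are exactly those of the form
   e_{z_1,k_1} ... e_{z_r,k_r} with z_i != 0 and k_i >= 1, uniquely; [blocks]
   recovers ((z_1,k_1), ..., (z_r,k_r)), and returns None on the other words
   (those that begin with e_0).  See [blocksP] and [blocks_e_idx]. *)
Definition blocks (w : {fmonom C}) : option (seq (C * nat)) :=
  let: (n, s) := parse w in if n == 0%N then Some s else None.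

Definition linext (f : {fmonom C} -> H) (x : H) : H := mmap malgC f x.

Definition bilinext (f : {fmonom C} -> {fmonom C} -> H) (x y : H) : H :=
  linext (fun u => linext (f u) y) x.

(* Both sides of [1 <= `|z|] are real elements of R[i]. *)
Definition Hsh (x : H) : Prop :=
  forall w, w \in msupp x -> all (fun z : C => (z == 0) || (1 <= `|z|)) w.

Definition Hsh1 (x : H) : Prop :=
  exists (c : rat) (s : seq (C * H)),
    (forall t, t \in s -> 1 <= `|t.1| /\ Hsh t.2) /\
    x = c%:MP + \sum_(t <- s) e_ t.1 * t.2.

Definition Hsh0 (x : H) : Prop :=
  exists (c : rat) (s : seq (C * H)) (s' : seq (C * H * C)),
    (forall t, t \in s -> 1 <= `|t.1| /\ Hsh t.2) /\
    (forall t, t \in s' ->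
       [/\ 1 <= `|t.1.1|, Hsh t.1.2, 1 <= `|t.2| & t.2 != 1]) /\
    x = c%:MP + \sum_(t <- s) e_ t.1 * t.2 * e_ 0
              + \sum_(t <- s') e_ t.1.1 * t.1.2 * e_ t.2.

(* Arguments are reversed words, since the recursion removes last letters. *)
Fixpoint shuffle_rev (u : seq C) : seq C -> H :=
  match u with
  | [::] => fun v => << FMonom (rev v) >>
  | a :: u' => fix shuffle_a (v : seq C) : H :=
      match v with
      | [::] => << FMonom (rev (a :: u')) >>
      | b :: v' => shuffle_rev u' (b :: v') * e_ a + shuffle_a v' * e_ b
      end
  end.

Definition shuffle : H -> H -> H :=
  bilinext (fun u v => shuffle_rev (rev u) (rev v)).

(* z_{i+1} / z_i, with the convention z_{r+1} = 1. *)
Fixpoint top_idx (s : seq (C * nat)) : seq (C * nat) :=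
  if s is (z, k) :: s' then
    ((if s' is (z', _) :: _ then z' else 1) / z, k) :: top_idx s'
  else [::].

(* Extended by 0 to the words beginning with e_0. *)
Definition top : H -> H :=
  linext (fun w => if blocks w is Some s then e_idx (top_idx s) else 0).

(* Arguments are reversed index sequences. *)
Fixpoint harm_rev (s : seq (C * nat)) : seq (C * nat) -> H :=
  match s with
  | [::] => fun t => e_idx (rev t)
  | (x, k) :: s' => fix harm_xk (t : seq (C * nat)) : H :=
      match t with
      | [::] => e_idx (rev ((x, k) :: s'))
      | (y, l) :: t' =>
          harm_rev s' ((y, l) :: t') * e_pow x k
          + harm_xk t' * e_pow y l
          + harm_rev s' t' * e_pow (x * y) (k + l)
      end
  end.

(* Extended by 0 to the words beginning with e_0. *)
Definition harm : H -> H -> H :=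
  bilinext (fun u v =>
    if blocks u is Some s then
      if blocks v is Some t then harm_rev (rev s) (rev t) else 0
    else 0).

(* Sum over 0 < n_1 < ... < n_r < N. *)
Definition L_idx (N : nat) (s : seq (C * nat)) : C :=
  \sum_(n : (size s).-tuple 'I_N | path ltn 0%N (map val n))
    \prod_(i < size s)
      let: (x, k) := tnth (in_tuple s) i in
      x ^+ tnth n i / (tnth n i)%:R ^+ k.

(* Extended by 0 to the words beginning with e_0. *)
Definition L_lt (N : nat) : H -> C :=
  mmap ratr (fun w => if blocks w is Some s then L_idx N s else 0).

Lemma malgUM (u v : {fmonom C}) : << u >> * << v >> = << mmul u v >> :> H.
Proof. by rewrite [LHS]fgmulUU mulr1. Qed.

Lemma e_word (w : seq C) : \prod_(a <- w) e_ a = << FMonom w >>.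
Proof.
elim: w => [|a w IHw]; first by rewrite big_nil -fmoneE.
by rewrite big_cons IHw /e_ malgUM fmuE /mmul /= fmmulE.
Qed.

Lemma e_powE (z : C) (k : nat) : e_pow z k = << FMonom (z :: nseq k.-1 0) >>.
Proof.
rewrite -e_word big_cons; congr (_ * _).
by elim: k.-1 => [|n IHn]; rewrite ?big_nil ?expr0 //= big_cons -IHn exprS.
Qed.

Lemma e_idxE (s : seq (C * nat)) :
  e_idx s = << FMonom (flatten [seq zk.1 :: nseq zk.2.-1 0 | zk <- s]) >>.
Proof.
rewrite -e_word big_flatten big_map; apply: eq_bigr => -[z k] _.
by rewrite e_powE e_word.
Qed.

Lemma parse_zeros (n : nat) (w : seq C) :
  parse (nseq n 0 ++ w) = ((parse w).1 + n, (parse w).2)%N.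
Proof.
elim: n => [|n IHn] /=; first by rewrite addn0; case: parse.
by rewrite -/(parse (nseq n 0 ++ w)) IHn eqxx addnS.
Qed.

Lemma blocks_e_idx (s : seq (C * nat)) : valid_idx s ->
  blocks (FMonom (flatten [seq zk.1 :: nseq zk.2.-1 0 | zk <- s])) = Some s.
Proof.
move=> vs; rewrite /blocks /=.
suff -> : parse (flatten [seq zk.1 :: nseq zk.2.-1 0 | zk <- s]) = (0%N, s).
  by [].
elim: s vs => [|[z k] s IHs] //= /andP[/andP[z0 k0] vs].
rewrite -/(parse (nseq k.-1 0 ++ _)) parse_zeros IHs //= (negbTE z0).
by rewrite add0n prednK.
Qed.

Lemma parse_sound (w : seq C) : let: (n, s) := parse w in
  valid_idx s /\
  w = nseq n 0 ++ flatten [seq zk.1 :: nseq zk.2.-1 0 | zk <- s].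
Proof.
elim: w => [|a w] //=; rewrite -/(parse w); case: parse => n s [vs ->].
by case: eqVneq => [->|a0] //=; rewrite a0 vs.
Qed.

Lemma blocksP (w : {fmonom C}) (s : seq (C * nat)) :
  blocks w = Some s -> valid_idx s /\ << w >> = e_idx s.
Proof.
rewrite /blocks; have := parse_sound w; case: parse => n t [vt wt].
case: eqP => // n0 [<-]; split=> //.
by rewrite e_idxE -[w]fmK wt n0.
Qed.

Lemma blocks_None (w : {fmonom C}) :
  (blocks w == None) = (if w : seq C is a :: _ then a == 0 else false).
Proof.
rewrite /blocks; case: w => -[|a w] //=; rewrite -/(parse w).
by case: (a == 0).
Qed.

Lemma linextU (f : {fmonom C} -> H) (u : {fmonom C}) : linext f << u >> = f u.
Proof. by rewrite /linext mmapU mul1r. Qed.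

Lemma bilinextU (f : {fmonom C} -> {fmonom C} -> H) (u v : {fmonom C}) :
  bilinext f << u >> << v >> = f u v.
Proof. by rewrite /bilinext !linextU. Qed.

Lemma shuffle1l (w : {fmonom C}) : shuffle 1 << w >> = << w >>.
Proof. by rewrite /shuffle bilinextU fm1 /= revK fmK. Qed.

Lemma shuffle1r (w : {fmonom C}) : shuffle << w >> 1 = << w >>.
Proof.
rewrite /shuffle bilinextU fm1 -[RHS]/(<< w >>) -{2}[w]fmK -{2}[w : seq C]revK.
by case: (rev w).
Qed.

Lemma shuffleE (w w' : {fmonom C}) (a b : C) :
  shuffle (<< w >> * e_ a) (<< w' >> * e_ b) =
    shuffle << w >> (<< w' >> * e_ b) * e_ a +
    shuffle (<< w >> * e_ a) << w' >> * e_ b.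
Proof.
by rewrite /shuffle !malgUM !bilinextU !fmM !fmU !rev_cat /=.
Qed.

Lemma top_e_idx (s : seq (C * nat)) :
  valid_idx s -> top (e_idx s) = e_idx (top_idx s).
Proof. by move=> vs; rewrite e_idxE /top linextU blocks_e_idx. Qed.

Lemma harm_e_idx (s t : seq (C * nat)) : valid_idx s -> valid_idx t ->
  harm (e_idx s) (e_idx t) = harm_rev (rev s) (rev t).
Proof.
by move=> vs vt; rewrite !(e_idxE, e_idxE t) /harm bilinextU !blocks_e_idx.
Qed.

Lemma harm1l (t : seq (C * nat)) : valid_idx t -> harm 1 (e_idx t) = e_idx t.
Proof.
move=> vt; have -> : 1 = e_idx [::] by rewrite /e_idx big_nil.
by rewrite harm_e_idx //= revK.
Qed.

Lemma harm1r (s : seq (C * nat)) : valid_idx s -> harm (e_idx s) 1 = e_idx s.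
Proof.
move=> vs; have -> : 1 = e_idx [::] by rewrite /e_idx big_nil.
rewrite harm_e_idx // -{2}[s]revK.
by case: (rev s) => [|[]].
Qed.

Lemma harmE (s t : seq (C * nat)) (x y : C) (k l : nat) :
  valid_idx s -> valid_idx t -> x != 0 -> y != 0 -> (0 < k)%N -> (0 < l)%N ->
  harm (e_idx s * e_pow x k) (e_idx t * e_pow y l) =
    harm (e_idx s) (e_idx t * e_pow y l) * e_pow x k +
    harm (e_idx s * e_pow x k) (e_idx t) * e_pow y l +
    harm (e_idx s) (e_idx t) * e_pow (x * y) (k + l).
Proof.
move=> vs vt x0 y0 k0 l0.
have cons_r r z j : e_idx r * e_pow z j = e_idx (rcons r (z, j)).
  by rewrite /e_idx big_rcons.
have valid_r r z j : valid_idx r -> z != 0 -> (0 < j)%N ->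
    valid_idx (rcons r (z, j)).
  by rewrite /valid_idx all_rcons /= => -> -> ->.
by rewrite !cons_r !harm_e_idx ?valid_r // !rev_rcons.
Qed.

Lemma L_lt_e_idx (N : nat) (s : seq (C * nat)) :
  valid_idx s -> L_lt N (e_idx s) = L_idx N s.
Proof.
by move=> vs; rewrite e_idxE /L_lt mmapU blocks_e_idx //= rmorph1 mul1r.
Qed.

End Words.

(* Main.v *)
Require Import Defs.
From mathcomp Require Import all_boot all_order all_algebra.
From mathcomp Require Import finmap complex monalg.
From mathcomp Require Import classical_sets reals topology normedtype.
From mathcomp Require Import landau exp.
From mathcomp Require Import ring.

Import Order.TTheory GRing.Theory Num.Theory.
Import numFieldNormedType.Exports.

Local Open Scope classical_set_scope.
Local Open Scope ring_scope.
Local Open Scope complex_scope.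

(** Attach to a word w = e_{z_1,k_1} ... e_{z_r,k_r} the power series
    F_w(x) = sum_n a_w(n) x^n given by F_1 = 1, x F'_{w e_0} = F_w and
    (z - x) F'_{w e_z} = F_w.  Then L_{<N}(top w) = sum_{n < N} a_w(n), while
    F_u F_v = F_{u sh v} by Leibniz' rule, and L_{<N} is multiplicative for the
    harmonic product.  Hence the quantity to be estimated is exactly
      sum_{n < N} a_{w_1}(n) sum_{N - n <= m < N} a_{w_0}(m).
    As all letters are 0 or of modulus at least 1, a_{w_1}(n) is O(log^p n / n).
    The tails sum_{M <= m < N} a_{w_0}(m) are O(log^q N / M): the terms are
    O(log^q m / m^2) if the last letter is e_0, and summation by parts applies
    if it is e_z with z <> 1.  So the defect is even O(log^m N / N). *)

(** * Cauchy products of coefficient sequences and their partial sums *)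

Section Convolution.
Set Implicit Arguments.
Unset Strict Implicit.
Context {F : fieldType}.
Implicit Types (f g : nat -> F) (a : F) (n : nat).

Definition conv f g n : F := \sum_(i < n.+1) f i * g (n - i)%N.

(* The coefficients of f(x) x / (a - x). *)
Fixpoint divser a f n : F :=
  if n is n'.+1 then (divser a f n' + f n') / a else 0.

(* a_w(n), where u is the word w reversed.  Because of 1 / 0 = 0, the words w
   beginning with e_0 get the zero series, which matches [top] on them. *)
Fixpoint coef (u : seq F) n : F :=
  if u is a :: u' then
    (if a == 0 then coef u' n else divser a (coef u') n) / n%:R
  else (n == 0%N)%:R.

Lemma convC f g n : conv f g n = conv g f n.
Proof.
rewrite /conv (reindex_inj rev_ord_inj) /=; apply: eq_bigr => i _.
by rewrite subSS subKn -1?ltnS ?ltn_ord 1?mulrC.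
Qed.

Lemma eq_conv f f' g g' : f =1 f' -> g =1 g' -> conv f g =1 conv f' g'.
Proof. by move=> ef eg n; apply: eq_bigr => i _; rewrite ef eg. Qed.

(** [divser a] is multiplication by the series x / (a - x), so it commutes with Cauchy products. *)
Lemma conv_divserl a f g n : a != 0 ->
  conv (divser a f) g n = divser a (conv f g) n.
Proof.
move=> a0; elim: n => [|n IHn]; first by rewrite /conv big_ord1 /= mul0r.
rewrite /conv big_ord_recl /= mul0r add0r -/(conv f g n) -IHn /conv.
rewrite -big_split /= mulr_suml; apply: eq_bigr => i _ /=.
by rewrite subSS; field.
Qed.

(** Leibniz' rule for x d/dx, read off on coefficients. *)
Lemma conv_muln f g n :
  n%:R * conv f g n =
  conv (fun i => i%:R * f i) g n + conv f (fun i => i%:R * g i) n.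
Proof.
rewrite /conv mulr_sumr -big_split /=; apply: eq_bigr => i _.
have ni : n%:R = i%:R + (n - i)%:R :> F by rewrite -natrD subnKC // -ltnS.
by rewrite ni; ring.
Qed.

Lemma sum_convE (f g : nat -> F) N :
  \sum_(n < N) conv f g n = \sum_(n < N) f n * \sum_(m < N - n) g m.
Proof.
elim: N => [|N IHN]; first by rewrite !big_ord0.
rewrite big_ord_recr {}IHN /=.
rewrite [RHS](eq_bigr (fun n : 'I_N.+1 =>
  f n * \sum_(m < N - n) g m + f n * g (N - n)%N)); last first.
  by move=> i _; rewrite -mulrDr subSn ?big_ord_recr // -ltnS.
by rewrite big_split big_ord_recr /= subnn big_ord0 mulr0 addr0.
Qed.

(** The square n, m < N minus the triangle n + m < N leaves the pairs with n + m >= N. *)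
Lemma mul_sum_sub_conv f g N :
  (\sum_(n < N) f n) * (\sum_(n < N) g n) - \sum_(n < N) conv f g n =
  \sum_(n < N) f n * \sum_(N - n <= m < N) g m.
Proof.
rewrite sum_convE mulr_suml -sumrB; apply: eq_bigr => n _.
rewrite -mulrBr -!(big_mkord xpredT g) (@big_cat_nat _ _ _ (N - n)) ?leq_subr //=.
by rewrite addrAC subrr add0r.
Qed.

End Convolution.

(** * Logarithmic bounds for coefficients and for tails of their sums *)

Section Bounds.
Set Implicit Arguments.
Unset Strict Implicit.

Context {F : numFieldType}.
Implicit Types (f g : nat -> F) (a C : F) (n m M N : nat) (u : seq F).

(* 1 + H_{N-1}: the term of index 0 is 0^-1 = 0. *)
Definition harmonic_succ N : F := 1 + \sum_(i < N) i%:R^-1.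
Local Notation h := harmonic_succ.

Lemma harmonic_succ_ge1 N : 1 <= h N.
Proof. by rewrite /h lerDl sumr_ge0 // => i _; rewrite invr_ge0 ler0n. Qed.

Lemma harmonic_succ_ge0 N : 0 <= h N.
Proof. exact: le_trans ler01 (harmonic_succ_ge1 N). Qed.

Hint Resolve harmonic_succ_ge0 harmonic_succ_ge1 : core.

Lemma harmonic_succ_mono M N : (M <= N)%N -> h M <= h N.
Proof.
move=> MN; rewrite /h lerD2l -(subnKC MN) big_split_ord /= lerDl.
by apply: sumr_ge0 => i _; rewrite invr_ge0 ler0n.
Qed.

Lemma harmonic_succX_mono p q M N : (M <= N)%N -> (p <= q)%N ->
  h M ^+ p <= h N ^+ q.
Proof.
move=> MN pq; apply: (@le_trans _ _ (h N ^+ p)).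
  by apply: lerXn2r (harmonic_succ_mono MN); rewrite nnegrE.
by rewrite ler_weXn2l.
Qed.

(** The summand is 1 at index 0 and 1 / i elsewhere; this is the envelope used for all coefficients
    below. *)
Lemma sum_unit_inv_le N : \sum_(i < N) ((i == 0 :> nat)%:R + i%:R^-1) <= h N.
Proof.
rewrite /h big_split /= lerD2r; case: N => [|N]; first by rewrite big_ord0.
by rewrite big_ord_recl big1 ?addr0.
Qed.

(** Unrolled, [divser a f n] is the sum of f(i) / a^(n - i) over i < n, and the powers of a have
    modulus at least 1. *)
Lemma divser_le a f n : 1 <= `|a| ->
  `|divser a f n| <= \sum_(i < n) `|f i|.
Proof.
move=> a1; elim: n => [|n IHn] /=; first by rewrite normr0 big_ord0.
rewrite normrM normfV big_ord_recr /=.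
have a0 : 0 < `|a| by apply: lt_le_trans a1.
rewrite ler_pdivrMr //; apply: le_trans (ler_normD _ _) _.
apply: le_trans (_ : _ <= \sum_(i < n) `|f i| + `|f n|) _; first by rewrite lerD2r.
by rewrite ler_peMr // addr_ge0 ?sumr_ge0.
Qed.

Definition letters_ok u := all (fun z : F => (z == 0) || (1 <= `|z|)) u.

Lemma sum_coef_le u N p :
  (forall n, `|coef u n| <= h n ^+ p * ((n == 0%N)%:R + n%:R^-1)) ->
  \sum_(i < N) `|coef u i| <= h N ^+ p.+1.
Proof.
move=> H; rewrite exprSr.
apply: le_trans (ler_wpM2l (exprn_ge0 _ _) (sum_unit_inv_le N)) => //.
rewrite mulr_sumr; apply: ler_sum => i _; apply: le_trans (H i) _.
by rewrite ler_wpM2r ?addr_ge0 ?ler0n ?invr_ge0 // harmonic_succX_mono // ltnW.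
Qed.

(** Each letter divides by n, which supplies the factor 1 / n. Before that, the letter 0 changes
    nothing, while a nonzero letter is bounded by a partial sum of the previous coefficients, at the
    cost of one more factor [h]. *)
Lemma coef_le u n : letters_ok u ->
  `|coef u n| <= h n ^+ size u * ((n == 0%N)%:R + n%:R^-1).
Proof.
elim: u n => [|a u IHu] n /=.
  by rewrite expr0 mul1r ger0_norm ?ler0n // lerDl invr_ge0.
move=> /andP[a1 uok]; rewrite normrM normfV normr_nat.
case: n => [|n].
  rewrite invr0 mulr0 mulr_ge0 ?exprn_ge0 //.
  by rewrite addr_ge0 ?ler0n ?invr_ge0.
rewrite [_ == 0%N]/= add0r ler_wpM2r ?invr_ge0 //.
case: ifPn a1 => [_ _|a0 /= a1].
  apply: le_trans (IHu _ uok) _; rewrite add0r.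
  apply: le_trans (_ : _ <= h n.+1 ^+ size u * 1) _.
    by rewrite ler_wpM2l ?exprn_ge0 // invf_le1 ?ltr0n // ler1n.
  by rewrite mulr1 harmonic_succX_mono.
rewrite -[(_ + _) / a]/(divser a (coef u) n.+1).
apply: le_trans (divser_le _ _ a1) _; by apply: sum_coef_le => m; exact: IHu.
Qed.

(** Each term is 1 / m - 1 / (m + 1). *)
Lemma sum_telescope_inv M N : (0 < M <= N)%N ->
  \sum_(M <= m < N) (m%:R * m.+1%:R)^-1 <= M%:R^-1 :> F.
Proof.
move=> /andP[M0 MN].
rewrite (eq_big_nat _ _ (F2 := fun m => - (m.+1%:R)^-1 - (- m%:R^-1))).
  by rewrite telescope_sumr // opprK addrC gerDl oppr_le0 invr_ge0 ler0n.
move=> m /andP[Mm _].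
have m0 : m%:R != 0 :> F by rewrite pnatr_eq0 -lt0n (leq_trans M0).
have m1 : 1 + m%:R != 0 :> F by rewrite nat1r pnatr_eq0.
by rewrite opprK -nat1r; field; rewrite m0 m1.
Qed.

(** The letter 0 divides by m once more, so the terms are bounded by a power of [h] over m^2. The
    factor 2 comes from 1 / m^2 <= 2 / (m (m + 1)), which telescopes. *)
Lemma sum_coef_tail_le0 u M N : letters_ok u -> (0 < M <= N)%N ->
  `|\sum_(M <= m < N) coef (0 :: u) m| <= 2 * h N ^+ size u / M%:R.
Proof.
move=> uok MN0; have /andP[M0 MN] := MN0; apply: le_trans (ler_norm_sum _ _ _) _.
have H0 : 0 <= 2 * h N ^+ size u by rewrite mulr_ge0 ?exprn_ge0.
apply: le_trans (ler_wpM2l H0 (sum_telescope_inv MN0)).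
rewrite mulr_sumr big_nat [leRHS]big_nat; apply: ler_sum => m /andP[Mm mN].
have m0 : (0 < m)%N by apply: leq_trans Mm.
rewrite /= eqxx normrM normfV normr_nat.
apply: le_trans (_ : h N ^+ size u / m%:R / m%:R <= _).
  rewrite ler_wpM2r ?invr_ge0 //; apply: le_trans (coef_le _ uok) _.
  rewrite gtn_eqF // add0r ler_wpM2r ?invr_ge0 //.
  by rewrite harmonic_succX_mono // ltnW.
rewrite [2 * _]mulrC -!mulrA ler_wpM2l ?exprn_ge0 // -invfM.
rewrite -ler_pdivrMl // -[leLHS]invfM lef_pV2 ?posrE ?mulr_gt0 ?ltr0n //.
by rewrite mulrCA -!natrM ler_nat leq_mul2l mul2n -addnn -ltn_subLR ?subnn ?m0 ?orbT.
Qed.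

(** The terms are only known to be O(1 / m) up to logarithms. The cancellation needed comes from a
    <> 1, through a division by a - 1. *)
Lemma sum_coef_tail_le a u M N : letters_ok (a :: u) -> a != 0 -> a != 1 ->
  (0 < M <= N)%N ->
  `|\sum_(M <= m < N) coef (a :: u) m| <=
  (2 * `|a| + 2) / `|a - 1| * h N ^+ (size u).+1 / M%:R.
Proof.
move=> /= /andP[a1 uok] a0 an1 MN0; have /andP[M0 MN] := MN0.
rewrite (negbTE a0) /= in a1 *.
(* Summation by parts, from a c(m + 1) = c(m) + b(m). *)
set c := divser a (coef u); set b := coef u; set H := h N ^+ _.
have H0 : 0 <= H by rewrite exprn_ge0.
have b_le m : (0 < m <= N)%N -> `|m%:R * b m| <= H.
  move=> /andP[m0 mN]; rewrite normrM normr_nat mulrC -ler_pdivlMr ?ltr0n //.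
  apply: le_trans (coef_le _ uok) _; rewrite gtn_eqF // add0r.
  by rewrite ler_wpM2r ?invr_ge0 // harmonic_succX_mono.
have c_le m : (m <= N)%N -> `|c m| <= H.
  move=> mN; apply: le_trans (divser_le _ _ a1) _.
  apply: le_trans (_ : h m ^+ (size u).+1 <= _); last exact: harmonic_succX_mono.
  by apply: sum_coef_le => i; apply: coef_le.
have E : (a - 1) * (\sum_(M <= m < N) c m / m%:R) =
    - (a * (c N / N%:R) - a * (c M / M%:R)) +
    \sum_(M <= m < N) (m%:R * b m - c m) / (m%:R * m.+1%:R).
  rewrite -(telescope_sumr (fun m => a * (c m / m%:R)) MN) -sumrN -big_split mulr_sumr /=.
  rewrite big_nat [RHS]big_nat; apply: eq_bigr => m /andP[Mm _].
  have m0 : m%:R != 0 :> F by rewrite pnatr_eq0 -lt0n (leq_trans M0).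
  have m1 : 1 + m%:R != 0 :> F by rewrite nat1r pnatr_eq0.
  rewrite (_ : c m.+1 = (c m + b m) / a) // -nat1r; field; rewrite a0 m0 m1 //.
have a10 : 0 < `|a - 1| by rewrite normr_gt0 subr_eq0.
have -> : (2 * `|a| + 2) / `|a - 1| * H / M%:R =
    (2 * `|a| + 2) * H / M%:R / `|a - 1| by ring.
rewrite ler_pdivlMr // mulrC -normrM E.
(* The two boundary terms account for 2|a| in the constant, the remaining sum for 2. *)
apply: le_trans (ler_normD _ _) _; rewrite 2!mulrDl lerD //.
  rewrite normrN; apply: le_trans (ler_normB _ _) _.
  rewrite [2]mulr2n !mulrDl !mul1r !normrM !normfV !normr_nat !mulrA lerD //.
    rewrite -!mulrA ler_wpM2l // ler_pM ?invr_ge0 // ?c_le //.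
    by rewrite lef_pV2 ?posrE ?ltr0n ?ler_nat // (leq_trans M0).
  by rewrite -!mulrA ler_wpM2l // ler_wpM2r ?invr_ge0 ?c_le.
apply: le_trans (ler_norm_sum _ _ _) _.
have H2 : 0 <= 2 * H by rewrite mulr_ge0.
apply: le_trans (ler_wpM2l H2 (sum_telescope_inv MN0)).
rewrite mulr_sumr big_nat [leRHS]big_nat; apply: ler_sum => m /andP[Mm mN].
rewrite normrM normfV normrM !normr_nat ler_wpM2r ?invr_ge0 ?mulr_ge0 //.
apply: le_trans (ler_normB _ _) _; rewrite [2]mulr2n mulrDl !mul1r lerD //.
  by rewrite b_le // (leq_trans M0) // ltnW.
by rewrite c_le // ltnW.
Qed.

(** Partial fractions: 1 / (n (N - n)) = (1 / n + 1 / (N - n)) / N, and each half sums to at most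
    [h N]. *)
Lemma sum_inv_mul N : (0 < N)%N ->
  \sum_(n < N) (n%:R * (N - n)%:R)^-1 <= 2 * h N / N%:R :> F.
Proof.
(* The factors [(0 < n)%:R] remove n = 0, where the left side is 0^-1 = 0 but 1 / (N - n) is not
   0. *)
move=> N0; rewrite (eq_bigr (fun n : 'I_N =>
  ((0 < n)%:R / n%:R + (0 < n)%:R / (N - n)%:R) / N%:R)); last first.
  move=> [[|n] nN] _ /=; first by rewrite !mul0r invr0 addr0 mul0r.
  rewrite !mul1r.
  have n0 : n.+1%:R != 0 :> F by rewrite pnatr_eq0.
  have m0 : (N - n.+1)%:R != 0 :> F by rewrite pnatr_eq0 subn_eq0 -ltnNge.
  have NE : N%:R = n.+1%:R + (N - n.+1)%:R :> F by rewrite -natrD subnKC // ltnW.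
  have N1 : n.+1%:R + (N - n.+1)%:R != 0 :> F by rewrite -NE pnatr_eq0 -lt0n.
  rewrite NE; move: (n.+1%:R) ((N - n.+1)%:R) n0 m0 N1 => x y x0 y0 xy.
  by field; rewrite x0 y0 xy.
rewrite -mulr_suml ler_wpM2r ?invr_ge0 // big_split /= [2]mulr2n mulrDl !mul1r.
have le1 : \sum_(i < N) i%:R^-1 <= h N by rewrite /h lerDr.
rewrite lerD //.
  apply: le_trans le1; apply: ler_sum => i _.
  by case: (0 < i)%N; rewrite ?mul1r // mul0r invr_ge0.
apply: le_trans le1; case: N N0 => // N _.
rewrite big_ord_recl mul0r add0r.
rewrite (reindex_inj rev_ord_inj) [leRHS]big_ord_recl invr0 add0r /=.
apply: ler_sum => i _; rewrite mul1r /bump !add1n subSS subKn //.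
Qed.

Definition inv_bounded f :=
  exists C p, 0 <= C /\
    forall n, `|f n| <= C * h n ^+ p * ((n == 0%N)%:R + n%:R^-1).

Definition tail_bounded g :=
  exists C q, 0 <= C /\ forall M N, (0 < M <= N)%N ->
    `|\sum_(M <= m < N) g m| <= C * h N ^+ q / M%:R.

Lemma harmonic_succ_lincomb_le C C' p q N :
  0 <= C -> 0 <= C' ->
  C * h N ^+ p + C' * h N ^+ q <= (C + C') * h N ^+ maxn p q.
Proof.
move=> C0 C'0; rewrite mulrDl lerD // ler_wpM2l //.
  by rewrite harmonic_succX_mono // leq_maxl.
by rewrite harmonic_succX_mono // leq_maxr.
Qed.

Lemma inv_bounded_lincomb (I : eqType) (r : seq I) (c : I -> F)
    (f : I -> nat -> F) : {in r, forall i, inv_bounded (f i)} ->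
  inv_bounded (fun n => \sum_(i <- r) c i * f i n).
Proof.
elim: r => [|i r IHr] fr.
  by exists 0, 0%N; split=> // n; rewrite big_nil normr0 !mul0r.
have [C [p [C0 Cf]]] := fr i (mem_head _ _).
have [|D [q [D0 Dr]]] := IHr; first by move=> j jr; apply: fr; rewrite inE jr orbT.
exists (`|c i| * C + D), (maxn p q); split; first by rewrite addr_ge0 ?mulr_ge0.
move=> n; rewrite big_cons; apply: le_trans (ler_normD _ _) _.
have e0 : 0 <= (n == 0%N)%:R + n%:R^-1 :> F by rewrite addr_ge0 ?ler0n ?invr_ge0.
have L := harmonic_succ_lincomb_le p q n (mulr_ge0 (normr_ge0 (c i)) C0) D0.
apply: le_trans (ler_wpM2r e0 L); rewrite mulrDl lerD ?Dr //.
by rewrite normrM -!mulrA ler_wpM2l // mulrA Cf.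
Qed.

Lemma tail_bounded_lincomb (I : eqType) (r : seq I) (c : I -> F)
    (g : I -> nat -> F) : {in r, forall i, tail_bounded (g i)} ->
  tail_bounded (fun n => \sum_(i <- r) c i * g i n).
Proof.
elim: r => [|i r IHr] gr.
  exists 0, 0%N; split=> // M N _; rewrite big1 ?normr0 ?mul0r // => m _.
  by rewrite big_nil.
have [C [p [C0 Cg]]] := gr i (mem_head _ _).
have [|D [q [D0 Dr]]] := IHr; first by move=> j jr; apply: gr; rewrite inE jr orbT.
exists (`|c i| * C + D), (maxn p q); split; first by rewrite addr_ge0 ?mulr_ge0.
move=> M N MN; under eq_bigr do rewrite big_cons.
rewrite big_split -mulr_sumr /=; apply: le_trans (ler_normD _ _) _.
have e0 : 0 <= M%:R^-1 :> F by rewrite invr_ge0.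
have L := harmonic_succ_lincomb_le p q N (mulr_ge0 (normr_ge0 (c i)) C0) D0.
apply: le_trans (ler_wpM2r e0 L); rewrite mulrDl lerD ?Dr //.
by rewrite normrM -!mulrA ler_wpM2l // mulrA Cg.
Qed.

Lemma inv_bounded_coef u : letters_ok u -> inv_bounded (coef u).
Proof.
by move=> uok; exists 1, (size u); split=> // n; rewrite mul1r coef_le.
Qed.

Lemma tail_bounded_coef u : letters_ok u -> head 0 u != 1 ->
  tail_bounded (coef u).
Proof.
case: u => [|a u] uok a1.
  (* The series of the empty word is the constant 1, so its tails from M > 0 vanish. *)
  exists 0, 0%N; split=> // M N /andP[M0 _].
  rewrite big_nat big1 ?normr0 ?mul0r // => m /andP[/(leq_trans M0) m0 _].
  by rewrite /= gtn_eqF.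
have [a0|a0] := eqVneq a 0.
  exists 2, (size u); split=> // M N; rewrite a0; apply: sum_coef_tail_le0.
  by have /andP[] := uok.
exists ((2 * `|a| + 2) / `|a - 1|), (size u).+1; split.
  by rewrite divr_ge0 ?addr_ge0 ?mulr_ge0.
by move=> M N; apply: sum_coef_tail_le.
Qed.

(** Up to logarithms the tail from N - n is O(1 / (N - n)) and its weight is O(1 / n); [sum_inv_mul]
    then gives 2 h(N) / N, hence the exponent p + q + 1. *)
Lemma product_tail_le f g : inv_bounded f -> tail_bounded g ->
  exists C q, 0 <= C /\ forall N, (0 < N)%N ->
    `|\sum_(n < N) f n * \sum_(N - n <= m < N) g m| <= C * h N ^+ q / N%:R.
Proof.
move=> [D [p [D0 f_le]]] [C [q [C0 g_le]]].
exists (D * C * 2), (p + q).+1; split; first by rewrite !mulr_ge0.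
move=> N N0; apply: le_trans (ler_norm_sum _ _ _) _.
have -> : D * C * 2 * h N ^+ (p + q).+1 / N%:R =
    D * C * h N ^+ (p + q) * (2 * h N / N%:R) by rewrite exprSr; ring.
have H0 : 0 <= D * C * h N ^+ (p + q) by rewrite !mulr_ge0 ?exprn_ge0.
apply: le_trans (ler_wpM2l H0 (sum_inv_mul N0)).
rewrite mulr_sumr; apply: ler_sum => -[[|n] nN] _ /=.
  (* For n = 0 the inner range, from N to N, is empty. *)
  by rewrite subn0 big_geq // mulr0 normr0 !mulr_ge0 ?invr_ge0 ?mulr_ge0 ?exprn_ge0.
rewrite normrM.
apply: le_trans (_ : D * h N ^+ p / n.+1%:R * (C * h N ^+ q / (N - n.+1)%:R) <= _).
  rewrite ler_pM // ?g_le ?subn_gt0 ?nN ?leq_subr //.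
  apply: le_trans (f_le _) _; rewrite add0r ler_wpM2r ?invr_ge0 // ler_wpM2l //.
  by rewrite harmonic_succX_mono // ltnW.
by rewrite exprD invfM le_eqVlt; apply/orP; left; apply/eqP; ring.
Qed.

End Bounds.

(** * Linear extension from words, and truncated sums of harmonic products *)

Section TruncatedSums.
Set Implicit Arguments.
Unset Strict Implicit.
Context {R : realType}.
Local Notation C := R[i].
Local Notation H := (frakH R).
Implicit Types (f : {fmonom C} -> C) (g x y : H) (s t : seq (C * nat)).

Definition lin_eval f x : C := mmap ratr f x.

Lemma lin_eval_is_additive f : {morph lin_eval f : x y / x + y}.
Proof. exact: mmapD. Qed.

Lemma lin_evalU f w : lin_eval f << w >> = f w.
Proof. by rewrite /lin_eval mmapU /= rmorph1 mul1r. Qed.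

Lemma lin_evalCM f c x : lin_eval f (c%:MP * x) = ratr c * lin_eval f x.
Proof.
rewrite mul_malgC /lin_eval (mmapEw (msuppZ_le _ _)) mmapE mulr_sumr.
by apply: eq_bigr => w _; rewrite mcoeffZ /= rmorphM -mulrA.
Qed.

Lemma lin_eval_sum f (I : Type) (r : seq I) (G : I -> H) :
  lin_eval f (\sum_(i <- r) G i) = \sum_(i <- r) lin_eval f (G i).
Proof. by rewrite /lin_eval raddf_sum. Qed.

Lemma eq_lin_eval f f' x : f =1 f' -> lin_eval f x = lin_eval f' x.
Proof. by move=> ff; apply: eq_bigr => w _; rewrite ff. Qed.

(** Reduces statements on [top], [harm] and [shuffle], all built with [linext], to single words. *)
Lemma lin_eval_linext f (G : {fmonom C} -> H) x :
  lin_eval f (linext G x) = lin_eval (fun w => lin_eval f (G w)) x.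
Proof.
rewrite /linext mmapE lin_eval_sum /lin_eval [RHS]mmapE; apply: eq_bigr => w _.
exact: lin_evalCM.
Qed.

Lemma lin_eval_mulU f x w : lin_eval f (x * << w >>) = lin_eval (fun u => f (mmul u w)) x.
Proof.
rewrite {1}(monalgE x) mulr_suml lin_eval_sum; apply: eq_bigr => u _.
by rewrite [_ * _]fgmulUU mulr1 /lin_eval mmapU.
Qed.

Lemma lin_eval_lincomb (I : Type) (r : seq I) (c : I -> C) (F : I -> {fmonom C} -> C) x :
  lin_eval (fun w => \sum_(i <- r) c i * F i w) x = \sum_(i <- r) c i * lin_eval (F i) x.
Proof.
rewrite /lin_eval mmapE; under eq_bigr do rewrite mulr_sumr.
rewrite exchange_big; apply: eq_bigr => i _; rewrite mulr_sumr.
by apply: eq_bigr => w _; rewrite mulrCA.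
Qed.

Lemma lin_evalZ f (c : C) x : lin_eval (fun w => c * f w) x = c * lin_eval f x.
Proof. by rewrite /lin_eval !mmapE mulr_sumr; apply: eq_bigr => w _; rewrite mulrCA. Qed.

Lemma lin_evalD f f' x : lin_eval (fun w => f w + f' w) x = lin_eval f x + lin_eval f' x.
Proof. by rewrite /lin_eval !mmapE -big_split; apply: eq_bigr => w _; rewrite mulrDr. Qed.

Definition word_idx s : seq C := flatten [seq zk.1 :: nseq zk.2.-1 0 | zk <- s].

Lemma blocks_Some (w : {fmonom C}) s :
  blocks w = Some s -> valid_idx s /\ w = FMonom (word_idx s).
Proof.
rewrite /blocks; have := parse_sound w; case: Defs.parse => n t [vt wt].
by case: eqP => // n0 [<-]; split=> //; rewrite -[w]fmK wt n0.
Qed.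

Lemma blocks_mul_e_pow (w : {fmonom C}) z k : z != 0 -> (0 < k)%N ->
  blocks (mmul w (FMonom (z :: nseq k.-1 0))) =
  omap (fun s => rcons s (z, k)) (blocks w).
Proof.
move=> z0 k0; case E: (blocks w) => [s|] /=.
  have [vs ->] := blocks_Some E; rewrite -[mmul _ _]fmK fmM /=.
  have -> : word_idx s ++ z :: nseq k.-1 0 = word_idx (rcons s (z, k)).
    by rewrite /word_idx map_rcons flatten_rcons.
  by rewrite blocks_e_idx // /valid_idx all_rcons z0 k0.
(* A word rejected by [blocks] begins with e_0, and still does after a block is appended. *)
move/eqP: E; rewrite blocks_None => w0.
apply/eqP; rewrite blocks_None fmM.
by case: (w : seq C) w0.
Qed.

(* [L_idx N] on the reversed index sequence. *)
Fixpoint L_rev (N : nat) s : C :=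
  if s is (x, k) :: s' then \sum_(n < N) x ^+ n / n%:R ^+ k * L_rev n s' else 1.

(* The sum over p < n_1 < ... < n_r < N. *)
Fixpoint L_from (p N : nat) s : C :=
  if s is (x, k) :: s' then
    \sum_(n < N | (p < n)%N) x ^+ n / n%:R ^+ k * L_from n N s'
  else 1.

Lemma tuple_sum_cons m N (F : m.+1.-tuple 'I_N -> C) (P : pred (m.+1.-tuple 'I_N)) :
  \sum_(n : m.+1.-tuple 'I_N | P n) F n =
  \sum_(j < N) \sum_(n : m.-tuple 'I_N | P [tuple of j :: n]) F [tuple of j :: n].
Proof.
rewrite pair_big_dep /=.
rewrite (reindex (fun p : 'I_N * m.-tuple 'I_N => [tuple of p.1 :: p.2])) /=.
  by [].
exists (fun n => (thead n, [tuple of behead n])) => [[j n] _|n _] /=.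
  by congr (_, _); apply: val_inj.
by rewrite -tuple_eta.
Qed.

(** The free lower bound [p] carries the induction: once n_1 is chosen, it bounds the remaining
    indices from below. *)
Lemma L_from_tuple p N s :
  \sum_(n : (size s).-tuple 'I_N | path ltn p (map val n))
    \prod_(i < size s)
      (let: (x, k) := tnth (in_tuple s) i in
       x ^+ tnth n i / (tnth n i)%:R ^+ k) = L_from p N s.
Proof.
elim: s p => [|[x k] s IHs] p /=.
  rewrite (big_pred1 [tuple]); first by rewrite big_ord0.
  by move=> n; rewrite (tuple0 n); apply/esym/eqP.
rewrite tuple_sum_cons [RHS]big_mkcond; apply: eq_bigr => j _ /=.
case: ifP => pj /=; last by rewrite big_pred0.
rewrite -IHs mulr_sumr; apply: eq_bigr => n _.
rewrite big_ord_recl /=; congr (_ * _).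
apply: eq_bigr => i _.
by rewrite !(tnth_nth (x, k)) !(tnth_nth j) /=.
Qed.

(** Exchanging the sums makes the largest index outermost, as the recursions on last letters
    require. *)
Lemma L_from_rcons p N s (x : C) k :
  L_from p N (rcons s (x, k)) =
  \sum_(n < N | (p < n)%N) x ^+ n / n%:R ^+ k * L_from p n s.
Proof.
elim: s p => [|[y l] s IHs] p //=.
under eq_bigr => j _ do rewrite IHs mulr_sumr.
rewrite (exchange_big_dep (fun n : 'I_N => (p < n)%N)) /=; last first.
  by move=> i j /ltn_trans; apply.
apply: eq_bigr => n pn; rewrite mulr_sumr.
rewrite (big_ord_widen_cond N _ (fun i => x ^+ n / n%:R ^+ k *
  (y ^+ i / i%:R ^+ l * L_from i n s))) ?(ltnW (ltn_ord n)) //.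
by apply: eq_bigr => j _; rewrite mulrCA.
Qed.

Lemma L_idx_rev N s : valid_idx s -> L_idx N s = L_rev N (rev s).
Proof.
rewrite /L_idx L_from_tuple; elim/last_ind: s N => [|s [x k] IHs] N //.
rewrite /valid_idx all_rcons /= => /andP[/andP[_ k0] vs].
rewrite L_from_rcons rev_rcons /= big_mkcond; apply: eq_bigr => n _.
(* [L_rev] also sums over n = 0, but that term is 0 because k > 0 and 0^-1 = 0. *)
case: posnP => [->|_]; last by rewrite IHs.
by rewrite expr0n gtn_eqF // invr0 mulr0 mul0r.
Qed.

Definition L_word N (w : {fmonom C}) : C :=
  if blocks w is Some s then L_idx N s else 0.

Lemma L_lt_eval N x : L_lt N x = lin_eval (L_word N) x.
Proof. by []. Qed.

Lemma L_ltD N : {morph @L_lt R N : x y / x + y}.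
Proof. exact: mmapD. Qed.

Lemma L_lt_mul_e_pow N g (x : C) k : x != 0 -> (0 < k)%N ->
  L_lt N (g * e_pow x k) = \sum_(n < N) x ^+ n / n%:R ^+ k * L_lt n g.
Proof.
move=> x0 k0; rewrite e_powE L_lt_eval lin_eval_mulU -lin_eval_lincomb.
apply: eq_lin_eval => w; rewrite /L_word blocks_mul_e_pow //.
case E: (blocks w) => [s|] /=; last by rewrite big1 // => n _; rewrite mulr0.
have [vs _] := blocks_Some E.
rewrite L_idx_rev ?rev_rcons /=; last by rewrite /valid_idx all_rcons /= x0 k0.
by apply: eq_bigr => n _; rewrite L_idx_rev.
Qed.

Lemma valid_idx_cons (x : C) k s :
  valid_idx ((x, k) :: s) = [&& x != 0, (0 < k)%N & valid_idx s].
Proof. by rewrite andbA. Qed.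

(** The pairs of indices are split into the two strict orders and the diagonal, matching the three
    terms of the harmonic recursion. *)
Lemma mul_sum_sum (A B : nat -> C) N :
  (\sum_(n < N) A n) * (\sum_(n < N) B n) =
  \sum_(n < N) A n * \sum_(m < n) B m + \sum_(n < N) B n * \sum_(m < n) A m +
  \sum_(n < N) A n * B n.
Proof.
elim: N => [|N IHN]; first by rewrite !big_ord0 mul0r !addr0.
by rewrite !big_ord_recr /= mulrDl mulrDr IHN; ring.
Qed.

(** Double induction along the recursion of [harm_rev], for all [N] at once: the inductive
    hypotheses are used at the outermost summation index. *)
Lemma L_lt_harm_rev N s t : valid_idx s -> valid_idx t ->
  L_lt N (harm_rev s t) = L_rev N s * L_rev N t.
Proof.
have L_e_idx M r : valid_idx r -> L_lt M (e_idx (rev r)) = L_rev M r.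
  by move=> vr; rewrite L_lt_e_idx ?L_idx_rev ?revK ?/valid_idx ?all_rev.
elim: s t N => [|[x k] s IHs] t N; first by move=> _ vt; rewrite L_e_idx // mul1r.
move=> /[dup] vxs; rewrite valid_idx_cons => /and3P[x0 k0 vs].
elim: t N => [|[y l] t IHt] N vt; first by rewrite L_e_idx //= mulr1.
have := vt; rewrite valid_idx_cons => /and3P[y0 l0 vt'].
have -> : harm_rev ((x, k) :: s) ((y, l) :: t) =
    harm_rev s ((y, l) :: t) * e_pow x k +
    harm_rev ((x, k) :: s) t * e_pow y l +
    harm_rev s t * e_pow (x * y) (k + l) by [].
have xy0 : x * y != 0 by rewrite mulf_neq0.
have kl0 : (0 < k + l)%N by rewrite addn_gt0 k0.
rewrite L_ltD L_ltD [L_rev N ((x, k) :: s)]/= [L_rev N ((y, l) :: t)]/=.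
rewrite (mul_sum_sum (fun n => x ^+ n / n%:R ^+ k * L_rev n s)
  (fun n => y ^+ n / n%:R ^+ l * L_rev n t)).
congr (_ + _ + _).
- by rewrite L_lt_mul_e_pow //; apply: eq_bigr => n _; rewrite IHs // mulrA.
- rewrite L_lt_mul_e_pow //; apply: eq_bigr => n _; rewrite IHt //=.
  by rewrite mulrCA [RHS]mulrC.
- rewrite L_lt_mul_e_pow //; apply: eq_bigr => n _; rewrite IHs //.
  by rewrite exprMn exprD invfM; ring.
Qed.

Lemma L_lt_harm N x y : L_lt N (harm x y) = L_lt N x * L_lt N y.
Proof.
rewrite L_lt_eval /harm /bilinext lin_eval_linext.
transitivity (lin_eval (fun u => L_lt N y * L_word N u) x); last first.
  by rewrite lin_evalZ mulrC.
apply: eq_lin_eval => u; rewrite lin_eval_linext mulrC -lin_evalZ; apply: eq_lin_eval => v.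
rewrite [in RHS]/L_word; case Eu: (blocks u) => [s|]; last first.
  by rewrite mul0r /lin_eval mmap0.
case Ev: (blocks v) => [t|]; last by rewrite mulr0 /lin_eval mmap0.
have [vs _] := blocks_Some Eu; have [vt _] := blocks_Some Ev.
rewrite -L_lt_eval L_lt_harm_rev ?/valid_idx ?all_rev //.
by rewrite -!L_idx_rev.
Qed.

End TruncatedSums.

(** * Truncated sums of [top] as partial sums of F_w, and the shuffle product as a product of
    series *)

Section Top.
Set Implicit Arguments.
Unset Strict Implicit.
Context {R : realType}.
Local Notation C := R[i].
Local Notation H := (frakH R).
Implicit Types (g : H) (s t : seq (C * nat)) (u v : seq C).

Lemma coef_zeros j u n :
  coef (nseq j 0 ++ u) n = coef u n / n%:R ^+ j :> C.
Proof.
elim: j => [|j IHj]; first by rewrite expr0 invr1 mulr1.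
by rewrite /= eqxx IHj exprSr invfM mulrA.
Qed.

Lemma divserE (a : C) f n : a != 0 ->
  divser a f n = a ^- n * \sum_(j < n) a ^+ j * f j.
Proof.
move=> a0; elim: n => [|n IHn]; first by rewrite big_ord0 mulr0.
rewrite big_ord_recr /= IHn exprSr; field.
by rewrite a0 expf_neq0.
Qed.

(** The final 0 is the first letter e_0 of the word. It divides the unit series, which lives in
    degree 0, by n = 0, and this gives 0; later letters preserve the zero series. *)
Lemma coef_rcons0 u n : coef (rcons u 0) n = 0 :> C.
Proof.
elim: u n => [|a u IHu] n /=.
  by rewrite eqxx; case: n => [|n]; rewrite ?invr0 ?mulr0 ?mul0r.
rewrite IHu; case: ifP => _; first by rewrite mul0r.
suff -> : divser a (coef (rcons u 0)) n = 0 by rewrite mul0r.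
by elim: n => //= n ->; rewrite IHu addr0 mul0r.
Qed.

(* [top_idx] with the convention z_{r+1} = y. *)
Fixpoint top_to (y : C) s : seq (C * nat) :=
  if s is (z, k) :: s' then
    ((if s' is (z', _) :: _ then z' else y) / z, k) :: top_to y s'
  else [::].

(** The reason for a free [y]: once the last block is removed, its letter z takes over the role of
    [y]. *)
Lemma top_to_rcons y s z k :
  top_to y (rcons s (z, k)) = rcons (top_to z s) (y / z, k).
Proof. by elim: s => [|[z' k'] s IHs] //=; rewrite IHs; case: s {IHs} => [|[]]. Qed.

Lemma top_to1 s : top_to 1 s = top_idx s.
Proof. by elim: s => [|[z k] s IHs] //=; rewrite IHs. Qed.

Lemma valid_idx_rcons s (x : C) k :
  valid_idx (rcons s (x, k)) = [&& x != 0, (0 < k)%N & valid_idx s].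
Proof. by rewrite /valid_idx all_rcons andbA. Qed.

Lemma valid_top_to y s : y != 0 -> valid_idx s -> valid_idx (top_to y s).
Proof.
elim/last_ind: s y => [|s [z k] IHs] y y0 //.
rewrite top_to_rcons !valid_idx_rcons => /and3P[z0 k0 vs].
by rewrite mulf_neq0 ?invr_eq0 // k0 IHs.
Qed.

Lemma L_rev_cons N (x : C) k s :
  L_rev N ((x, k) :: s) = \sum_(n < N) x ^+ n / n%:R ^+ k * L_rev n s.
Proof. by []. Qed.

(** Induction on the last block: (y / z)^n meets the closed form [divserE] of [divser z], whose
    inner sum is the claim with z in place of y. *)
Lemma L_rev_top N y s : (0 < N)%N -> valid_idx s ->
  L_rev N (rev (top_to y s)) = \sum_(n < N) y ^+ n * coef (rev (word_idx s)) n.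
Proof.
elim/last_ind: s N y => [|s [z k] IHs] N y N0.
  (* [N] must be positive: the empty sequence gives 1, which is the coefficient of index 0. *)
  move=> _; case: N N0 => // N _.
  by rewrite big_ord_recl big1 /= ?mulr1 ?addr0 // => i _; rewrite mulr0.
rewrite valid_idx_rcons => /and3P[z0 k0 vs].
rewrite top_to_rcons rev_rcons L_rev_cons; apply: eq_bigr => n _.
rewrite /word_idx map_rcons flatten_rcons rev_cat rev_cons rev_nseq cat_rcons.
rewrite coef_zeros [coef (z :: _) _]/= (negbTE z0) -/(word_idx s).
have kE : n%:R ^+ k = n%:R ^+ k.-1 * n%:R :> C by rewrite -exprSr prednK.
(* The induction hypothesis asks for n > 0; at n = 0 both sides vanish through 0^-1 = 0. *)
have [->|n0] := posnP n; first by rewrite expr0n gtn_eqF // invr0 mulr0 !mul0r mulr0.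
rewrite IHs // divserE // kE expr_div_n invfM /=; ring.
Qed.

Lemma L_top_word N (w : {fmonom C}) : (0 < N)%N ->
  L_lt N (if blocks w is Some s then e_idx (top_idx s) else 0) =
  \sum_(n < N) coef (rev w) n.
Proof.
move=> N0; case E: (blocks w) => [s|].
  have [vs ->] := blocks_Some E.
  rewrite -top_to1 L_lt_e_idx ?valid_top_to ?oner_neq0 //.
  rewrite L_idx_rev ?valid_top_to ?oner_neq0 // L_rev_top //.
  by apply: eq_bigr => n _; rewrite expr1n mul1r.
move/eqP: E; rewrite blocks_None /L_lt mmap0; case: (w : seq C) => // a u /eqP ->.
by rewrite big1 // => n _; rewrite rev_cons coef_rcons0.
Qed.

(** The coefficient of x^n in F_g, with F extended linearly from words. *)
Definition Kcoef n g : C := lin_eval (fun w => coef (rev w) n) g.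

Lemma L_lt_top N g : (0 < N)%N -> L_lt N (top g) = \sum_(n < N) Kcoef n g.
Proof.
move=> N0; rewrite L_lt_eval /top lin_eval_linext.
transitivity (lin_eval (fun w => \sum_(n < N) 1 * coef (rev w) n) g).
  apply: eq_lin_eval => w; rewrite -L_lt_eval L_top_word //.
  by apply: eq_bigr => n _; rewrite mul1r.
by rewrite lin_eval_lincomb; apply: eq_bigr => n _; rewrite mul1r.
Qed.

Lemma lin_eval_divser a (G : nat -> {fmonom C} -> C) n g :
  lin_eval (fun w => divser a (G^~ w) n) g =
  divser a (fun j => lin_eval (G j) g) n.
Proof.
elim: n => [|n IHn] /=.
  by rewrite /lin_eval mmapE big1 // => w _; rewrite mulr0.
rewrite -IHn -lin_evalD mulrC -lin_evalZ; apply: eq_lin_eval => w; exact: mulrC.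
Qed.

(** Coefficient form of x F'_{g e_0} = F_g and (a - x) F'_{g e_a} = F_g. *)
Lemma Kcoef_mul_e n g a : Kcoef n (g * e_ a) =
  (if a == 0 then Kcoef n g else divser a (Kcoef^~ g) n) / n%:R.
Proof.
rewrite /Kcoef /e_ lin_eval_mulU.
transitivity (lin_eval (fun w => n%:R^-1 *
    (if a == 0 then coef (rev w) n else divser a (coef (rev w)) n)) g).
  by apply: eq_lin_eval => w; rewrite fmM fmU rev_cat /= mulrC.
rewrite lin_evalZ mulrC; congr (_ / _); case: ifP => // _.
exact: lin_eval_divser (fun j w => coef (rev w) j) n g.
Qed.

Lemma KcoefD n : {morph Kcoef n : x y / x + y}.
Proof. exact: lin_eval_is_additive. Qed.

Lemma conv_delta f n : conv (@coef C [::]) f n = f n.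
Proof.
rewrite /conv big_ord_recl subn0 mul1r big1 ?addr0 // => i _.
by rewrite mul0r.
Qed.

Lemma eq_divser (a : C) f f' n : f =1 f' -> divser a f n = divser a f' n.
Proof. by move=> ff; elim: n => //= n ->; rewrite ff. Qed.

(** For n > 0 the division by n is undone. At n = 0 with a = 0 the constant term of [coef u] has to
    vanish: the condition on the first letter of the word makes u nonempty. *)
Lemma coef_theta a u : last 1 (a :: u) != 0 -> forall n,
  n%:R * coef (a :: u) n =
  if a == 0 then coef u n else divser a (coef u) n.
Proof.
move=> ln0 [|n]; last by rewrite mulrC divfK // pnatr_eq0.
rewrite mul0r; case: ifP => // /eqP a0; move: ln0; rewrite a0.
case: u => [|b u]; first by rewrite /= eqxx.
by rewrite /= invr0 mulr0.
Qed.

Lemma conv_theta a u f n : last 1 (a :: u) != 0 ->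
  conv (fun i => i%:R * coef (a :: u) i) f n =
  if a == 0 then conv (coef u) f n else divser a (conv (coef u) f) n.
Proof.
move=> ln0; rewrite (eq_conv (coef_theta ln0) (frefl f)).
by have [//|a0] := eqVneq a 0; rewrite conv_divserl.
Qed.

Lemma last_behead_neq0 (a : C) u : last 1 (a :: u) != 0 -> last 1 u != 0.
Proof. by case: u => //= _; exact: oner_neq0. Qed.

(** The two terms of Leibniz' rule for x d/dx are the two terms of the shuffle recursion, one for
    each last letter. *)
Lemma Kcoef_shuffle_rev u v n : last 1 u != 0 -> last 1 v != 0 ->
  Kcoef n (shuffle_rev u v) = conv (coef u) (coef v) n.
Proof.
elim: u v n => [|a u IHu] v n.
  by move=> _ _; rewrite conv_delta /Kcoef lin_evalU revK.
move=> lu; elim: v n => [|b v IHv] n lv.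
  by rewrite convC conv_delta /Kcoef /= lin_evalU revK.
have -> : shuffle_rev (a :: u) (b :: v) =
  shuffle_rev u (b :: v) * e_ a + shuffle_rev (a :: u) v * e_ b by [].
have lu' := last_behead_neq0 lu; have lv' := last_behead_neq0 lv.
apply: etrans (KcoefD _ _ _) _.
apply: etrans (congr2 +%R (Kcoef_mul_e _ _ _) (Kcoef_mul_e _ _ _)) _.
rewrite -mulrDl.
rewrite (eq_divser _ _ (fun m => IHu (b :: v) m lu' lv)) (IHu _ _ lu' lv).
rewrite (eq_divser _ _ (fun m => IHv m lv')) (IHv _ lv').
(* At n = 0, where multiplying by n loses information, both sides are 0 because of 1 / 0 = 0. *)
case: n => [|n].
  by rewrite invr0 mulr0 /conv big_ord1 /= invr0 !mulr0.
apply: (canLR (mulfK _)); first by rewrite pnatr_eq0.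
(* Multiplication by n is the derivation x d/dx. *)
rewrite [RHS]mulrC conv_muln conv_theta //; congr (_ + _).
rewrite [RHS]convC conv_theta //; case: ifP => _; first exact: convC.
by apply: eq_divser => m; apply: convC.
Qed.

End Top.

(** * Words occurring in the two spaces, and the exact defect *)

Section Support.
Set Implicit Arguments.
Unset Strict Implicit.
Context {R : realType}.
Local Notation C := R[i].
Local Notation H := (frakH R).
Local Notation W := {fmonom C}.
Implicit Types (x y : H) (P Q S : pred W).

Definition supported P x := forall w, w \in msupp x -> P w.

Lemma supportedD P x y : supported P x -> supported P y -> supported P (x + y).
Proof.
move=> Px Py w /(fsubsetP (msuppD_le _ _)); rewrite in_fsetU.
by case/orP => [/Px|/Py].
Qed.

Lemma supported0 P : supported P 0.
Proof. by move=> w; rewrite msupp0 in_fset0. Qed.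

Lemma supported_sum (I : eqType) (r : seq I) (F : I -> H) P :
  {in r, forall i, supported P (F i)} -> supported P (\sum_(i <- r) F i).
Proof.
move=> PF; rewrite big_seq; elim/big_rec: _ => [|i x ir]; first exact: supported0.
by apply: supportedD; apply: PF.
Qed.

Lemma supportedU P w (c : rat) : P w -> supported P << c *g w >>.
Proof. by move=> Pw u /(fsubsetP msuppU_le); rewrite in_fset1 => /eqP ->. Qed.

Lemma supportedM P Q S x y : (forall u v, P u -> Q v -> S (mmul u v)) ->
  supported P x -> supported Q y -> supported S (x * y).
Proof. by move=> PQS Px Qy w /msuppM_le[u [v [/Px Pu /Qy Qv ->]]]; apply: PQS. Qed.

Lemma supported_e P (z : C) : P (fmu z) -> supported P (e_ z).
Proof. exact: supportedU. Qed.

(** The default 1 of [head], like the default 0 of [last] in [Hsh0_word], admits the empty word. *)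
Definition Hsh1_word (w : W) := letters_ok w && (head 1 (w : seq C) != 0).

Definition Hsh0_word (w : W) := Hsh1_word w && (last 0 (w : seq C) != 1).

(** Here the default 0 of [head] excludes the empty word, so the first letter survives a
    multiplication on the right. *)
Lemma supported_e_mul (z : C) x : 1 <= `|z| -> Hsh x ->
  supported (fun w => letters_ok w && (head 0 (w : seq C) != 0)) (e_ z * x).
Proof.
move=> z1; apply: (@supportedM (pred1 (fmu z)) (fun w => letters_ok w)).
  move=> u v /eqP -> vok; rewrite fmM fmU /= z1 orbT vok.
  by rewrite -normr_gt0 (lt_le_trans ltr01).
by apply: supported_e => /=.
Qed.

Lemma supported_e_mul_e (z a : C) x :
  1 <= `|z| -> Hsh x -> (a == 0) || (1 <= `|a|) -> a != 1 ->
  supported Hsh0_word (e_ z * x * e_ a).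
Proof.
move=> z1 xok aok a1.
apply: (supportedM (Q := pred1 (fmu a)) _ (supported_e_mul z1 xok)); last first.
  by apply: supported_e => /=.
move=> u v /andP[uok u0] /eqP ->; rewrite /Hsh0_word /Hsh1_word fmM fmU.
rewrite /letters_ok all_cat last_cat /= aok a1 !andbT.
by rewrite [all _ _]uok; case: (u : seq C) u0 => //=; rewrite eqxx.
Qed.

Lemma Hsh1_supported x : Hsh1 x -> supported Hsh1_word x.
Proof.
move=> [c [s [sok ->]]]; apply: supportedD.
  by apply: supportedU; rewrite /Hsh1_word fm1 /= oner_neq0.
apply: supported_sum => t /sok[t1 t2] w /(supported_e_mul t1 t2).
rewrite /Hsh1_word => /andP[-> /=].
by case: (w : seq C) => //=; rewrite eqxx.
Qed.

Lemma Hsh0_supported x : Hsh0 x -> supported Hsh0_word x.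
Proof.
move=> [c [s [s' [sok [s'ok ->]]]]]; apply: supportedD; first apply: supportedD.
- apply: supportedU; rewrite /Hsh0_word /Hsh1_word fm1 /= oner_neq0.
  by rewrite eq_sym oner_neq0.
- apply: supported_sum => t /sok[t1 t2].
  by apply: supported_e_mul_e; rewrite ?eqxx // eq_sym oner_neq0.
- apply: supported_sum => t /s'ok[t1 t2 t3 t4].
  by apply: supported_e_mul_e; rewrite ?t3 ?orbT.
Qed.

Lemma last_rev (T : Type) (d : T) (u : seq T) : last d (rev u) = head d u.
Proof. by case: u => // a u; rewrite rev_cons last_rcons. Qed.

Lemma head_rev (T : Type) (d : T) (u : seq T) : head d (rev u) = last d u.
Proof. by rewrite -[in RHS](revK u) last_rev. Qed.

Lemma inv_bounded_Kcoef x : supported Hsh1_word x -> inv_bounded (Kcoef^~ x).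
Proof.
move=> ok; apply: (inv_bounded_lincomb (fun w : W => ratr x@_w)) => w.
move=> /ok/andP[wok _].
by apply: inv_bounded_coef; rewrite /letters_ok all_rev.
Qed.

Lemma tail_bounded_Kcoef x : supported Hsh0_word x -> tail_bounded (Kcoef^~ x).
Proof.
move=> ok; apply: (tail_bounded_lincomb (fun w : W => ratr x@_w)) => w.
move=> /ok/andP[/andP[wok _] w1].
by apply: tail_bounded_coef; rewrite ?head_rev // /letters_ok all_rev.
Qed.

Lemma eq_lin_eval_supported P (f f' : W -> C) x : supported P x ->
  (forall w, P w -> f w = f' w) -> lin_eval f x = lin_eval f' x.
Proof.
move=> Px ff; rewrite /lin_eval !mmapE big_seq [RHS]big_seq.
by apply: eq_bigr => w /Px /ff ->.
Qed.

Lemma Kcoef_shuffle n x y :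
  supported Hsh1_word x ->
  supported Hsh1_word y ->
  Kcoef n (shuffle x y) = conv (Kcoef^~ x) (Kcoef^~ y) n.
Proof.
move=> Px Py; rewrite /Kcoef /shuffle /bilinext lin_eval_linext.
transitivity (lin_eval (fun u =>
    \sum_(i < n.+1) Kcoef (n - i) y * coef (rev u) i) x).
  apply: (eq_lin_eval_supported Px) => u /andP[_ u0]; rewrite lin_eval_linext.
  transitivity (lin_eval (fun v =>
    \sum_(i < n.+1) coef (rev u) i * coef (rev v) (n - i)%N) y).
    apply: (eq_lin_eval_supported Py) => v /andP[_ v0].
    by apply: Kcoef_shuffle_rev; rewrite last_rev.
  rewrite (lin_eval_lincomb _ (fun i : 'I_n.+1 => coef (rev u) i)
    (fun (i : 'I_n.+1) (v : W) => coef (rev v) (n - i)%N)).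
  by apply: eq_bigr => i _; rewrite mulrC.
rewrite (lin_eval_lincomb _ (fun i : 'I_n.+1 => Kcoef (n - i) y)
    (fun (i : 'I_n.+1) (u : W) => coef (rev u) i)).
by apply: eq_bigr => i _; rewrite mulrC.
Qed.

(** [harm] gives a product of partial sums and [shuffle] the partial sum of a Cauchy product;
    [mul_sum_sub_conv] computes the difference. *)
Lemma L_lt_defect N x y : (0 < N)%N ->
  supported Hsh1_word x ->
  supported Hsh1_word y ->
  L_lt N (harm (top x) (top y) - top (shuffle x y)) =
  \sum_(n < N) Kcoef n x * \sum_(N - n <= m < N) Kcoef m y.
Proof.
move=> N0 Px Py.
rewrite -(mul_sum_sub_conv (Kcoef^~ x) (Kcoef^~ y)).
transitivity (L_lt N (harm (top x) (top y)) - L_lt N (top (shuffle x y))).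
  exact: mmapB.
congr (_ - _).
  apply: etrans (L_lt_harm _ _ _) _.
  by apply: congr2; apply: L_lt_top.
apply: etrans (L_lt_top _ N0) _.
by apply: eq_bigr => n _; apply: Kcoef_shuffle.
Qed.

End Support.

(** * From harmonic numbers to logarithms, and the final rate *)

Section Logarithm.
Set Implicit Arguments.
Unset Strict Implicit.
Context {R : realType}.

(** This is ln (1 + t) <= t at t = -1 / (n + 1). *)
Lemma inv_succ_le_ln n : (0 < n)%N -> n.+1%:R^-1 <= ln n.+1%:R - ln n%:R :> R.
Proof.
move=> n0; have n0R : 0 < n%:R :> R by rewrite ltr0n.
rewrite -lerN2 opprB -ln_div ?posrE ?ltr0n //.
have -> : n%:R / n.+1%:R = 1 + - n.+1%:R^-1 :> R.
  by rewrite -nat1r; field; rewrite nat1r pnatr_eq0.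
by apply: le_ln1Dx; rewrite ltrN2 invf_lt1 ?ltr0n // ltr1n ltnS.
Qed.

Lemma harmonic_succ_le_ln n : (0 < n)%N -> harmonic_succ n.+1 <= 2 + ln n%:R :> R.
Proof.
rewrite /harmonic_succ; case: n => // n _; elim: n => [|n IHn].
  by rewrite big_ord_recr big_ord1 /= invr0 invr1 ln1 add0r addr0.
rewrite big_ord_recr addrA; apply: le_trans (lerD IHn (inv_succ_le_ln (ltn0Sn n))) _.
by rewrite -addrA [_ + (_ - _)]addrC subrK.
Qed.

(** The coefficient bounds live in [R[i]], the logarithm in [R]. *)
Lemma harmonic_succ_complex n : harmonic_succ n = (harmonic_succ n : R)%:C.
Proof.
rewrite /harmonic_succ rmorphD rmorph1 rmorph_sum; congr (_ + _).
by apply: eq_bigr => i _; rewrite fmorphV rmorph_nat.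
Qed.

Lemma inv_le_powR_third n : (0 < n)%N -> n%:R^-1 <= n%:R `^ (- (1 / 3)) :> R.
Proof.
move=> n0; rewrite -powR_inv1 ?ler0n //; apply: ler_powR; first by rewrite ler1n.
by rewrite lerN2 ler_pdivrMr // mul1r ler1n.
Qed.

(** Once N >= e, the logarithm is at least 1: it absorbs the constant 2 of [harmonic_succ_le_ln] and
    lets the exponent rise from q to q + 1. *)
Lemma rate_bigO (f : nat -> R[i]) (K : R[i]) q : 0 <= K ->
  (forall N, (0 < N)%N -> `|f N| <= K * harmonic_succ N ^+ q / N%:R) ->
  (f : nat -> R[i]^o) =O_\oo
    (fun N : nat => (N%:R `^ (- (1 / 3)) * ln N%:R ^+ q.+1)%:C : R[i]^o).
Proof.
move=> K0 f_le; apply/eqOP/bigO_exP.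
(* 3^q comes from [harmonic_succ N <= 3 * ln N%:R]; adding 1 keeps the constant positive even if K =
   0. *)
exists (K * 3 ^+ q + 1); first by rewrite ltr_wpDl // mulr_ge0 ?exprn_ge0.
near=> N.
have N0 : (0 < N)%N by near: N; exact: nbhs_infty_gt.
have lnN : 1 <= ln N%:R :> R.
  rewrite -[leLHS](expRK 1) ler_ln ?posrE ?expR_gt0 ?ltr0n //.
  by near: N; exact: nbhs_infty_ger.
set g : R := N%:R `^ (- (1 / 3)) * ln N%:R ^+ q.+1.
have ln0 : 0 <= ln N%:R :> R by apply: le_trans lnN.
have g0 : 0 <= g by rewrite mulr_ge0 ?powR_ge0 ?exprn_ge0.
have h3 : harmonic_succ N <= 3 * ln N%:R :> R.
  apply: le_trans (harmonic_succ_mono (leqnSn N)) _.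
  apply: le_trans (harmonic_succ_le_ln N0) _.
  have -> : 3 * ln N%:R = 2 * ln N%:R + ln N%:R :> R by ring.
  rewrite lerD2r.
  by rewrite ler_peMr.
have key : harmonic_succ N ^+ q / N%:R <= 3 ^+ q * g.
  rewrite /g mulrCA [leLHS]mulrC; apply: ler_pM; rewrite ?invr_ge0 //.
  - by rewrite exprn_ge0 // harmonic_succ_ge0.
  - exact: inv_le_powR_third.
  apply: le_trans (_ : (3 * ln N%:R) ^+ q <= _).
    by apply: lerXn2r h3; rewrite nnegrE ?harmonic_succ_ge0 ?mulr_ge0.
  by rewrite exprMn ler_wpM2l ?exprn_ge0 // ler_weXn2l.
apply: le_trans (f_le N N0) _.
have -> : `|g%:C : R[i]^o| = g%:C :> R[i] by rewrite ger0_norm // lecR.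
rewrite harmonic_succ_complex -mulrA.
have -> : (harmonic_succ N : R)%:C ^+ q / N%:R = (harmonic_succ N ^+ q / N%:R : R)%:C.
  by rewrite rmorphM rmorphXn fmorphV rmorph_nat.
apply: le_trans (_ : K * (3 ^+ q * g)%:C <= _).
  by rewrite ler_wpM2l // lecR.
rewrite mulrDl mul1r rmorphM rmorphXn rmorph_nat mulrA lerDl lecR //.
Unshelve. all: by end_near. Qed.

End Logarithm.

Theorem theorem6p5 (R : realType) (w1 w0 : frakH R)
    (Hw1 : Hsh1 w1) (Hw0 : Hsh0 w0) :
  exists m : nat, (0 < m)%N /\
    (fun N : nat => L_lt N (harm (top w1) (top w0) - top (shuffle w1 w0))
       : R[i]^o)
    =O_\oo
    (fun N : nat => (N%:R `^ (- (1 / 3)) * ln N%:R ^+ m)%:C : R[i]^o).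
Proof.
have S1 := Hsh1_supported Hw1; have S0 := Hsh0_supported Hw0.
have [K [q [K0 bound]]] :=
  product_tail_le (inv_bounded_Kcoef S1) (tail_bounded_Kcoef S0).
(* Taking q + 1 makes the exponent positive whatever q is. *)
exists q.+1; split=> //; apply: (rate_bigO K0) => N N0.
have -> : L_lt N (harm (top w1) (top w0) - top (shuffle w1 w0)) =
    \sum_(n < N) Kcoef n w1 * \sum_(N - n <= m < N) Kcoef m w0.
  by apply: L_lt_defect => // w /S0/andP[].
exact: bound.
Qed.
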